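(* Let $m\in\mathbb N$, and for $k=1,\dots,m$ let $a_k,h_k:[0,\infty)\to\mathbb R$ satisfy $a_k(t)\ge 0$ and $h_k(t)\le t$ for all $t\ge 0$. For real $s\le t$ let $$\mathcal N(s,t)=\{\,s+j : j\in\{0,1,2,\dots\},\ s+j\le t-1\,\},\qquad \mathcal M(s,t)=\{\,t-j : j\in\mathbb N,\ t-j\ge s\,\},$$ where $\mathbb N=\{1,2,\dots\}$. Let $x$ be a positive non-increasing solution of $$x(t+1)-x(t)+\sum_{k=1}^m a_k(t)\,x(h_k(t))=0,\qquad t\ge 0.$$ Then, for any $0\le s<t<\infty$, $$x(t)\le x(s)\prod_{r\in\mathcal N(s,t)}\Big(1-\sum_{k=1}^m a_k(r)\Big)\qquad\text{and}\qquad x(t)\le x(s)\prod_{r\in\mathcal M(s,t)}\Big(1-\sum_{k=1}^m a_k(r)\Big).$$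
   Context: A solution is a function $x:\mathbb R\to\mathbb R$ satisfying the equation for all $t\ge 0$ (values on $(-\infty,1)$ are initial data; no regularity is required). It is positive non-increasing if $x(t)>0$ for all $t$ and $x$ is non-increasing on $\mathbb R$. Empty products equal $1$. *)

(* Defs.v *)
From mathcomp Require Import all_boot all_order all_algebra.
From mathcomp Require Import classical_sets functions cardinality fsbigop reals.

Set Implicit Arguments.
Unset Strict Implicit.
Unset Printing Implicit Defensive.
Import Order.TTheory GRing.Theory Num.Theory.

Local Open Scope classical_set_scope.
Local Open Scope ring_scope.

Definition Nset (R : realType) (s t : R) : set R :=
  [set s + j%:R | j in [set j : nat | s + j%:R <= t - 1]].

Definition Mset (R : realType) (s t : R) : set R :=
  [set t - j%:R | j in [set j : nat | (1 <= j)%N /\ s <= t - j%:R]].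

(* Products over these sets are written with the finitely supported big
   operator, which returns 1 when the support is infinite; the next two facts
   show that this default is never reached. *)
Lemma finite_Nset (R : realType) (s t : R) : finite_set (Nset s t).
Proof.
apply: finite_image; apply: (sub_finite_set _ (finite_II (Num.bound `|t - 1 - s|))).
move=> j /= sjt; rewrite -(ltr_nat R).
apply: le_lt_trans (archi_boundP (normr_ge0 _)).
apply: le_trans (ler_norm _).
by rewrite lerBrDl.
Qed.

Lemma finite_Mset (R : realType) (s t : R) : finite_set (Mset s t).
Proof.
apply: finite_image; apply: (sub_finite_set _ (finite_II (Num.bound `|t - s|))).
move=> j /= [_ sjt]; rewrite -(ltr_nat R).
apply: le_lt_trans (archi_boundP (normr_ge0 _)).
apply: le_trans (ler_norm _).
by rewrite lerBrDr addrC -lerBrDr.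
Qed.

(* Only the values of [a k] and [h k] on the half-line [0, +oo[ matter: they
   stand for functions defined there. *)
Definition is_solution (R : realType) (m : nat) (a h : 'I_m -> R -> R)
    (x : R -> R) : Prop :=
  forall t : R, 0 <= t ->
    x (t + 1) - x t + \sum_(k < m) a k t * x (h k t) = 0.

Definition positive_nonincreasing (R : realType) (x : R -> R) : Prop :=
  (forall t : R, 0 < x t) /\ {homo x : u v / u <= v >-> u >= v}.

(* Main.v *)
(* Since h_k(u) <= u and x is non-increasing, x(h_k(u)) >= x(u), so the equation
   gives x(u + 1) <= x(u) (1 - A(u)) for u >= 0, where A is the sum of the a_k;
   positivity of x forces 1 - A(u) > 0, so these bounds can be multiplied.
   With n the integer part of t - s, N(s, t) is {s, ..., s + n - 1} and M(s, t)
   is {t - n, ..., t - 1}. Iterating n times from s, and from t - n, and comparing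
   x(t) with x(s + n), respectively x(t - n) with x(s), gives the two bounds. *)

Require Import Defs.
From mathcomp Require Import all_boot all_order all_algebra.
From mathcomp Require Import classical_sets functions cardinality fsbigop reals.
From mathcomp Require Import lra.

Set Implicit Arguments.
Unset Strict Implicit.
Unset Printing Implicit Defensive.
Import Order.TTheory GRing.Theory Num.Theory.

Local Open Scope classical_set_scope.
Local Open Scope ring_scope.

(** For an integer [j], [j <= t - 1 - s] means [j + 1 <= t - s], so [j] lies strictly below the
    integer part of [t - s]. *)
Lemma Nset_progression (R : realType) (s t : R) : s <= t ->
  Nset s t = [set s + i%:R | i in `I_(Num.trunc (t - s))].
Proof.
move=> st; congr image; apply/seteqP.
by split=> j /=; rewrite truncn_gt_nat -natr1 => ?; lra.
Qed.

(** With [n] the integer part of [t - s], the substitution [i = n - j] reverses the order and turns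
    [1 <= j <= n] into [0 <= i < n]. *)
Lemma Mset_progression (R : realType) (s t : R) : s <= t ->
  Mset s t = [set t - (Num.trunc (t - s))%:R + i%:R
             | i in `I_(Num.trunc (t - s))].
Proof.
rewrite -subr_ge0 => st; set n := Num.trunc _; apply/seteqP; split=> r [j /=].
- move=> [j1 sj] <-.
  have jn : (j <= n)%N by rewrite truncn_ge_nat //; lra.
  exists (n - j)%N; first by rewrite /= ltn_subrL j1 (leq_trans j1).
  by rewrite natrB //; lra.
- move=> jn <-; exists (n - j)%N; last by rewrite natrB ?(ltnW jn) //; lra.
  rewrite /= subn_gt0; split=> //.
  have : (n - j <= n)%N by rewrite leq_subr.
  by rewrite truncn_ge_nat // => ?; lra.
Qed.

(** The shift of [i] by [u] is injective, so distinct indices give distinct factors. *)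
Lemma fsbig_progression (R : realType) (u : R) (n : nat) (F : R -> R) :
  \big[*%R/1%R]_(r \in [set u + i%:R | i in `I_n]) F r =
  \prod_(i < n) F (u + i%:R).
Proof.
rewrite fsbig_image -?fsbig_ord // => i j _ _ /addrI /eqP.
by rewrite eqr_nat => /eqP.
Qed.

Lemma solution_step (R : realType) (m : nat) (a h : 'I_m -> R -> R) (x : R -> R)
    (u : R) :
  (forall k t, 0 <= t -> 0 <= a k t) -> (forall k t, 0 <= t -> h k t <= t) ->
  is_solution a h x -> {homo x : v w / v <= w >-> v >= w} -> 0 <= u ->
  x (u + 1) <= x u * (1 - \sum_(k < m) a k u).
Proof.
move=> a_ge0 h_le x_sol x_ni u0.
have : \sum_(k < m) a k u * x u <= \sum_(k < m) a k u * x (h k u).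
  by apply: ler_sum => k _; rewrite ler_wpM2l ?a_ge0 ?x_ni ?h_le.
by rewrite -mulr_suml; have := x_sol u u0; nra.
Qed.

Lemma iterated_decay (R : realFieldType) (x b : R -> R) (u : R) (n : nat) :
  (forall v, 0 <= v -> 0 <= b v) ->
  (forall v, 0 <= v -> x (v + 1) <= x v * b v) -> 0 <= u ->
  x (u + n%:R) <= x u * \prod_(i < n) b (u + i%:R).
Proof.
move=> b_ge0 x_step u0; elim: n => [|n IH]; first by rewrite big_ord0 mulr1 addr0.
have un0 : 0 <= u + n%:R by rewrite addr_ge0.
rewrite -natr1 addrA big_ord_recr /= mulrA (le_trans (x_step _ un0)) //.
(* The induction hypothesis is multiplied by the nonnegative factor [b (u + n)]. *)
by rewrite ler_wpM2r ?b_ge0.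
Qed.

Theorem lemma3 (R : realType) (m : nat) (hm : (1 <= m)%N)
    (a h : 'I_m -> R -> R)
    (a_ge0 : forall (k : 'I_m) (t : R), 0 <= t -> 0 <= a k t)
    (h_le : forall (k : 'I_m) (t : R), 0 <= t -> h k t <= t)
    (x : R -> R) (x_sol : is_solution a h x)
    (x_posni : positive_nonincreasing x)
    (s t : R) (s_ge0 : 0 <= s) (lt_st : s < t) :
  x t <= x s * \big[*%R/1%R]_(r \in Nset s t) (1 - \sum_(k < m) a k r) /\
  x t <= x s * \big[*%R/1%R]_(r \in Mset s t) (1 - \sum_(k < m) a k r).
Proof.
have [x_gt0 x_ni] := x_posni.
pose b r := 1 - \sum_(k < m) a k r.
have x_step v : 0 <= v -> x (v + 1) <= x v * b v.
  by move=> v0; exact: solution_step a_ge0 h_le x_sol x_ni v0.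
have b_ge0 v : 0 <= v -> 0 <= b v.
  by move=> /x_step /(lt_le_trans (x_gt0 _)); rewrite pmulr_rgt0 // => /ltW.
have st := ltW lt_st.
rewrite (Nset_progression st) (Mset_progression st) !fsbig_progression.
set n := Num.trunc _.
(* This yields both [s + n <= t] and [0 <= s <= t - n]. *)
have nts : n%:R <= t - s by rewrite truncn_le subr_ge0.
split.
- by apply: le_trans (iterated_decay n b_ge0 x_step s_ge0); apply: x_ni; lra.
- have u0 : 0 <= t - n%:R by lra.
  have := iterated_decay n b_ge0 x_step u0; rewrite subrK => /le_trans; apply.
  (* The iteration ends exactly at [t], so monotonicity is used at its start, under a nonnegative
     product. *)
  rewrite ler_wpM2r ?x_ni //; last by lra.
  by apply: prodr_ge0 => i _; rewrite b_ge0 // addr_ge0.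
Qed.
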